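(* Let $\gamma\in\mathbb{C}$, $\gamma\neq0$, let $f_3=x^2+\gamma xy+y^2$, $f_4=x^2-\gamma xy+y^2$, and suppose $f_1,f_2\in\mathbb{C}[x,y]$ are even binary quadratic forms such that $f_1^3+f_2^3=f_3^3+f_4^3$ and $f_1,f_2,f_3,f_4$ are pairwise non-proportional. Then there are integers $k_1,k_2$ and a complex number $T$ with $T^3=1+\tfrac34\gamma^2$ such that $\omega^{k_1}f_1+\omega^{k_2}f_2=T(f_3+f_4)$; that is, the identity is (after multiplying $f_1,f_2$ by cube roots of unity) of Type$(T)$ with $T$ a cube root of $1+\tfrac34\gamma^2$.
   Context: $\omega=e^{2\pi i/3}$. A binary quadratic form is even if it has no $xy$ term, i.e. it is of the form $ax^2+cy^2$. An honest identity $g_1^3+g_2^3=g_3^3+g_4^3$ among pairwise non-proportional binary quadratic forms is of Type$(T)$ if, perhaps after replacing it by a flip ($g_1^3-g_3^3=-g_2^3+g_4^3$ or $g_1^3-g_4^3=-g_2^3+g_3^3$, with the forms relabeled accordingly), one has $g_1^3+g_2^3=g_3^3+g_4^3$ and $g_1+g_2=T(g_3+g_4)$. *)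

(* Defs.v *)
From mathcomp Require Import all_boot all_order all_algebra.
From mathcomp Require Import complex mpoly.
From mathcomp Require Import reals sequences trigo.

Set Implicit Arguments.
Unset Strict Implicit.
Unset Printing Implicit Defensive.

Import GRing.Theory.

Local Open Scope ring_scope.
Local Open Scope complex_scope.

(* For [R : realType], [R[i]] is the field of complex numbers, and polynomials
   in C[x, y] are elements of [{mpoly R[i][2]}] with x = 'X_0 and y = 'X_1. *)

Definition cexp (R : realType) (z : R[i]) : R[i] :=
  (expR (complex.Re z))%:C *
  (cos (complex.Im z) +i* sin (complex.Im z)).

Definition omega (R : realType) : R[i] := cexp (0 +i* (2 * pi / 3)).

Definition varx (R : realType) : {mpoly R[i][2]} := 'X_(0 : 'I_2).
Definition vary (R : realType) : {mpoly R[i][2]} := 'X_(1 : 'I_2).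

Definition even_quadratic_form (R : realType) (f : {mpoly R[i][2]}) : Prop :=
  exists a c : R[i], f = a *: varx R ^+ 2 + c *: vary R ^+ 2.

(* Linear dependence; in particular 0 is proportional to every form. *)
Definition proportional (R : realType) (f g : {mpoly R[i][2]}) : Prop :=
  exists a b : R[i], ((a != 0) \/ (b != 0)) /\ a *: f = b *: g.

Definition pairwise_nonproportional (R : realType)
    (g1 g2 g3 g4 : {mpoly R[i][2]}) : Prop :=
  [/\ ~ proportional g1 g2, ~ proportional g1 g3 & ~ proportional g1 g4] /\
  [/\ ~ proportional g2 g3, ~ proportional g2 g4 & ~ proportional g3 g4].

Definition honest_identity (R : realType)
    (g1 g2 g3 g4 : {mpoly R[i][2]}) : Prop :=
  [/\ [/\ g1 \is 2.-homog, g2 \is 2.-homog, g3 \is 2.-homog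
        & g4 \is 2.-homog],
      g1 ^+ 3 + g2 ^+ 3 = g3 ^+ 3 + g4 ^+ 3
    & pairwise_nonproportional g1 g2 g3 g4].

Definition type_relation (R : realType) (T : R[i])
    (g1 g2 g3 g4 : {mpoly R[i][2]}) : Prop :=
  g1 + g2 = T *: (g3 + g4).

(* Since - g ^+ 3 = (- g) ^+ 3, the flip g1^3 - g3^3 = - g2^3 + g4^3 is the
   sum-of-cubes identity for the quadruple (g1, - g3, - g2, g4), and
   g1^3 - g4^3 = - g2^3 + g3^3 is the one for (g1, - g4, - g2, g3). *)
Definition of_type (R : realType) (T : R[i])
    (g1 g2 g3 g4 : {mpoly R[i][2]}) : Prop :=
  honest_identity g1 g2 g3 g4 /\
  [\/ type_relation T g1 g2 g3 g4,
      type_relation T g1 (- g3) (- g2) g4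
    | type_relation T g1 (- g4) (- g2) g3].

(* Main.v *)
(* Put X = x^2 and Y = y^2, so that f3^3 + f4^3 = 2 (X + Y)^3 + 6 gamma^2 X Y (X + Y).
   At X = 1, Y = -1 this vanishes, so one linear factor f1 + omega^k f2 of
   f1^3 + f2^3 is a multiple of X + Y.  Its X- and Y-coefficients are the sums of
   two pairs with equal sums of cubes, so the pairs agree up to order;
   non-proportionality excludes the same order, so omega^k f2 is f1 with X and Y
   exchanged.  At X = Y = 1 the identity then reads 2 (2 T)^3 = 16 + 12 gamma^2. *)

Require Import Defs.
From mathcomp Require Import all_boot all_order all_algebra.
From mathcomp Require Import complex mpoly.
From mathcomp Require Import reals sequences exp trigo.
From mathcomp Require Import ring lra.

Set Implicit Arguments.
Unset Strict Implicit.
Unset Printing Implicit Defensive.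

Import Order.TTheory GRing.Theory Num.Theory.

Local Open Scope ring_scope.
Local Open Scope complex_scope.

Lemma cexp_imD (R : realType) (s t : R) :
  cexp (0 +i* (s + t)) = cexp (0 +i* s) * cexp (0 +i* t).
Proof.
rewrite /cexp /= expR0 !mul1r cosD sinD; simpc.
by congr (_ +i* _); ring.
Qed.

Lemma omega_exp3 (R : realType) : omega R ^+ 3 = 1.
Proof.
rewrite exprS expr2 /omega -!cexp_imD.
have -> : 2 * pi / 3 + (2 * pi / 3 + 2 * pi / 3) = pi *+ 2 :> R by field.
by rewrite /cexp /= expR0 cos2pi sin2pi mul1r.
Qed.

Lemma omega_neq1 (R : realType) : omega R != 1.
Proof.
apply/eqP; rewrite /omega /cexp /= expR0 mul1r => -[_] /eqP; apply/negP.
by rewrite gt_eqF// sin_gt0_pi//; have := pi_gt0 R; lra.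
Qed.

Lemma omega_cyclotomic (R : realType) : omega R ^+ 2 + omega R + 1 = 0.
Proof.
have /eqP : (omega R - 1) * (omega R ^+ 2 + omega R + 1) = 0.
  by rewrite -[RHS](subrr 1) -[X in _ = X - _](omega_exp3 R); ring.
by rewrite mulf_eq0 subr_eq0 (negPf (omega_neq1 R)) => /eqP.
Qed.

(** A primitive cube root of unity [w] splits the sum of cubes into the linear factors
    [p + w ^+ k * q], one of which must vanish. *)
Lemma sum_cubes_eq0 (F : fieldType) (w p q : F) :
  w ^+ 2 + w + 1 = 0 -> p ^+ 3 + q ^+ 3 = 0 ->
  exists k : nat, p + w ^+ k * q = 0.
Proof.
move=> w0 pq0.
have : (p + q) * (p + w * q) * (p + w ^+ 2 * q) = 0.
  (* The last bracket is the cofactor of [w ^+ 2 + w + 1] in the expanded product, so [ring] works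
     without reducing modulo [w0]. *)
  transitivity (p ^+ 3 + q ^+ 3 + (w ^+ 2 + w + 1) *
                (p ^+ 2 * q + w * p * q ^+ 2 + (w - 1) * q ^+ 3)).
    by ring.
  by rewrite pq0 w0 mul0r addr0.
move=> /eqP; rewrite !mulf_eq0 => /orP[/orP[]|] /eqP e.
- by exists 0%N; rewrite mul1r.
- by exists 1%N.
- by exists 2%N.
Qed.

(** With s = a + b, the sum of cubes is s^3 - 3 s a b. It is nonzero, so s is too, and s and the
    cubes determine the product: both pairs are the roots of one quadratic. *)
Lemma eq_sum_eq_sum_cubes (F : numFieldType) (a b c d : F) :
  a + b = c + d -> a ^+ 3 + b ^+ 3 = c ^+ 3 + d ^+ 3 -> a ^+ 3 + b ^+ 3 != 0 ->
  a = c /\ b = d \/ a = d /\ b = c.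
Proof.
move=> sum_eq cubes_eq cubes_neq0.
have bE : b = c + d - a by rewrite -sum_eq addrAC subrr add0r.
have sum_neq0 : c + d != 0.
  apply: contraNneq cubes_neq0 => s0; apply/eqP.
  by rewrite bE s0; ring.
have : 3 * (c + d) * ((a - c) * (a - d)) = 0.
  transitivity (a ^+ 3 + b ^+ 3 - (c ^+ 3 + d ^+ 3)); first by rewrite bE; ring.
  by rewrite cubes_eq subrr.
move=> /eqP; rewrite !mulf_eq0 pnatr_eq0 (negPf sum_neq0) !subr_eq0 /=.
by move=> /orP[] /eqP ac; [left | right]; split; rewrite // bE ac; ring.
Qed.

(** Here f1 = a X + c Y and f2 = b X + d Y. The four cube equations are the identity at (X, Y) = (1,
    0), (0, 1), (1, -1), (1, 1). *)
Lemma even_pair_coefficients (F : numFieldType) (w g a b c d : F) :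
  w ^+ 2 + w + 1 = 0 ->
  a ^+ 3 + b ^+ 3 = 2 -> c ^+ 3 + d ^+ 3 = 2 ->
  (a - c) ^+ 3 + (b - d) ^+ 3 = 0 ->
  (a + c) ^+ 3 + (b + d) ^+ 3 = 16 + 12 * g ^+ 2 ->
  a * d != b * c ->
  exists (k : nat) (T : F),
    [/\ T ^+ 3 = 1 + 3 / 4 * g ^+ 2, a + w ^+ k * b = T * 2
      & c + w ^+ k * d = T * 2].
Proof.
move=> w0 X3 Y3 at_antidiag at_diag indep.
have [k k0] := sum_cubes_eq0 w0 at_antidiag.
have w3 : w ^+ 3 = 1.
  apply/eqP; rewrite -subr_eq0.
  have -> : w ^+ 3 - 1 = (w - 1) * (w ^+ 2 + w + 1) by ring.
  by rewrite w0 mulr0.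
set u := w ^+ k in k0 *.
have u3 : u ^+ 3 = 1 by rewrite -exprM mulnC exprM w3 expr1n.
have sum_eq : a + u * b = c + u * d.
  by apply/eqP; rewrite -subr_eq0 -k0; apply/eqP; ring.
have uX3 : a ^+ 3 + (u * b) ^+ 3 = 2 by rewrite exprMn u3 mul1r.
have uY3 : c ^+ 3 + (u * d) ^+ 3 = 2 by rewrite exprMn u3 mul1r.
have u_neq0 : u != 0 by apply/eqP => u0; move/eqP: u3; rewrite u0 expr0n /= eq_sym oner_eq0.
have [| |[ac /(mulfI u_neq0) bd]|[ad bc]] := eq_sum_eq_sum_cubes sum_eq.
- by rewrite uX3 uY3.
- by rewrite uX3 pnatr_eq0.
(* Same order: f1 and f2 would both be multiples of X + Y. *)
- by move: indep; rewrite ac bd mulrC eqxx.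
(* The factor 2 comes from f3 + f4 = 2 (X + Y). *)
exists k, ((a + u * b) / 2); split; last 2 first.
- by rewrite divfK// pnatr_eq0.
- by rewrite divfK// pnatr_eq0.
have -> : g ^+ 2 = ((a + c) ^+ 3 + (b + d) ^+ 3 - 16) / 12.
  by rewrite at_diag; field.
(* Since u d = a, multiplying b + d by u gives a + u b, and u^3 = 1. *)
have -> : (b + d) ^+ 3 = (a + u * b) ^+ 3.
  by rewrite -[LHS]mul1r -u3 -exprMn mulrDr -ad addrC.
by rewrite -bc; field.
Qed.

Section Forms.
Variable R : realType.
Implicit Types (f g : {mpoly R[i][2]}) (c : R[i]).

Lemma proportional_scalel c f g :
  c != 0 -> proportional (c *: f) g -> proportional f g.
Proof.
move=> c0 [a [b [ab e]]]; exists (a * c), b; split; last by rewrite -scalerA.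
by case: ab => h; [left; rewrite mulf_neq0 | right].
Qed.

Lemma proportional_sym f g : proportional f g -> proportional g f.
Proof. by move=> [a [b [ab e]]]; exists b, a; split=> //; case: ab; tauto. Qed.

Lemma proportional_scaler c f g :
  c != 0 -> proportional f (c *: g) -> proportional f g.
Proof.
by move=> c0 /proportional_sym /(proportional_scalel c0) /proportional_sym.
Qed.

Definition form (a b c : R[i]) : {mpoly R[i][2]} :=
  a *: varx R ^+ 2 + b *: (varx R * vary R) + c *: vary R ^+ 2.

Lemma form_homog (a b c : R[i]) : form a b c \is 2.-homog.
Proof.
have hX (i : 'I_2) : ('X_i : {mpoly R[i][2]}) \is 1.-homog.
  rewrite dhomogX; apply/eqP/mdeg1.
have hM (i j : 'I_2) : ('X_i * 'X_j : {mpoly R[i][2]}) \is 2.-homog.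
  exact: (dhomogM (hX i) (hX j)).
rewrite /form !expr2.
by apply: rpredD; [apply: rpredD|]; apply: rpredZ; apply: hM.
Qed.

Lemma even_formE (a c : R[i]) :
  a *: varx R ^+ 2 + c *: vary R ^+ 2 = form a 0 c.
Proof. by rewrite /form scale0r addr0. Qed.

Lemma formD a b c a' b' c' :
  form a b c + form a' b' c' = form (a + a') (b + b') (c + c').
Proof. by rewrite /form !scalerDl; ring. Qed.

Lemma formZ t a b c : t *: form a b c = form (t * a) (t * b) (t * c).
Proof. by rewrite /form !scalerDr !scalerA. Qed.

Lemma meval_form (v : 'I_2 -> R[i]) a b c :
  (form a b c).@[v] = a * v 0 ^+ 2 + b * (v 0 * v 1) + c * v 1 ^+ 2.
Proof. by rewrite /form !expr2 !mevalD !mevalZ !mevalM !mevalXU. Qed.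

(** The x^2-coefficients serve as multipliers unless both vanish. Then both forms are multiples of
    y^2, and the y^2-coefficients serve unless the first form is zero. *)
Lemma even_form_proportional (a b c d : R[i]) :
  a * d = b * c -> proportional (form a 0 c) (form b 0 d).
Proof.
move=> adbc; have [a0|a0] := eqVneq a 0; last first.
  exists b, a; split; first by right.
  by rewrite !formZ !mulr0 [b * a]mulrC adbc.
have [b0|b0] := eqVneq b 0; last first.
  exists b, a; split; first by left.
  by rewrite !formZ !mulr0 [b * a]mulrC adbc.
have [c0|c0] := eqVneq c 0.
  exists 1, 0; split; first by left; exact: oner_neq0.
  by rewrite !formZ a0 c0 !mulr0 !mul0r.
exists d, c; split; first by right.
by rewrite !formZ a0 b0 !mulr0 [d * c]mulrC.
Qed.

End Forms.

Theorem theorem3p1 (R : realType) (gamma : R[i])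
  (f1 f2 f3 f4 : {mpoly R[i][2]})
  (gamma_neq0 : gamma != 0)
  (f3E : f3 = varx R ^+ 2 + gamma *: (varx R * vary R) + vary R ^+ 2)
  (f4E : f4 = varx R ^+ 2 - gamma *: (varx R * vary R) + vary R ^+ 2)
  (f1_even : even_quadratic_form f1)
  (f2_even : even_quadratic_form f2)
  (f_identity : f1 ^+ 3 + f2 ^+ 3 = f3 ^+ 3 + f4 ^+ 3)
  (f_nonprop : pairwise_nonproportional f1 f2 f3 f4) :
  exists (k1 k2 : int) (T : R[i]),
    [/\ T ^+ 3 = 1 + 3 / 4 * gamma ^+ 2,
        omega R ^ k1 *: f1 + omega R ^ k2 *: f2 = T *: (f3 + f4)
      & of_type T (omega R ^ k1 *: f1) (omega R ^ k2 *: f2) f3 f4].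
Proof.
have [a [c f1E]] := f1_even; have [b [d f2E]] := f2_even.
rewrite even_formE in f1E; rewrite even_formE in f2E.
have {}f3E : f3 = form 1 gamma 1 by rewrite f3E /form !scale1r.
have {}f4E : f4 = form 1 (- gamma) 1 by rewrite f4E /form !scale1r scaleNr.
have at_point (s t : R[i]) :
    (a * s ^+ 2 + c * t ^+ 2) ^+ 3 + (b * s ^+ 2 + d * t ^+ 2) ^+ 3 =
    (s ^+ 2 + gamma * (s * t) + t ^+ 2) ^+ 3 +
    (s ^+ 2 - gamma * (s * t) + t ^+ 2) ^+ 3.
  have := congr1 (meval (fun i : 'I_2 => if i == 0 then s else t)) f_identity.
  rewrite f1E f2E f3E f4E !mevalD !rmorphXn /= !meval_form /=.
  by rewrite !mul0r !addr0 !mul1r mulNr.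
have X3 : a ^+ 3 + b ^+ 3 = 2.
  by transitivity ((a * 1 ^+ 2 + c * 0 ^+ 2) ^+ 3 + (b * 1 ^+ 2 + d * 0 ^+ 2) ^+ 3);
    [ring | rewrite at_point; ring].
have Y3 : c ^+ 3 + d ^+ 3 = 2.
  by transitivity ((a * 0 ^+ 2 + c * 1 ^+ 2) ^+ 3 + (b * 0 ^+ 2 + d * 1 ^+ 2) ^+ 3);
    [ring | rewrite at_point; ring].
have at_diag : (a + c) ^+ 3 + (b + d) ^+ 3 = 16 + 12 * gamma ^+ 2.
  by transitivity ((a * 1 ^+ 2 + c * 1 ^+ 2) ^+ 3 + (b * 1 ^+ 2 + d * 1 ^+ 2) ^+ 3);
    [ring | rewrite at_point; ring].
have at_antidiag : (a - c) ^+ 3 + (b - d) ^+ 3 = 0.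
  (* Y = -1 is reached at y = i, where f3 and f4 take the opposite values gamma i and - gamma i. *)
  have := at_point 1 'i; rewrite sqr_i expr1n !mulr1 !mulrN1 => ->.
  by rewrite mul1r; ring: (sqr_i R).
have [[np12 np13 np14] [np23 np24 np34]] := f_nonprop.
have indep : a * d != b * c.
  by apply/eqP => /even_form_proportional; rewrite -f1E -f2E.
have [k [T [T3 sumX sumY]]] := even_pair_coefficients
  (omega_cyclotomic R) X3 Y3 at_antidiag at_diag indep.
have u3 : (omega R ^+ k) ^+ 3 = 1.
  by rewrite -exprM mulnC exprM omega_exp3 expr1n.
have u_neq0 : omega R ^+ k != 0.
  by apply/eqP => u0; move/eqP: u3; rewrite u0 expr0n /= eq_sym oner_eq0.
have sumE : omega R ^ 0 *: f1 + omega R ^ k *: f2 = T *: (f3 + f4).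
  rewrite -exprnP scale1r f1E f2E f3E f4E formZ !formD formZ.
  by rewrite subrr !mulr0 addr0 sumX sumY.
exists 0, k%:Z, T; split=> //; split; last by apply: Or31.
rewrite -exprnP scale1r in sumE *; split.
- by rewrite f1E f2E f3E f4E !formZ !form_homog.
- by rewrite exprZn u3 scale1r.
(* Rescaling f2 by a nonzero constant preserves non-proportionality; only the three pairs containing
   f2 change. *)
split; split=> //.
- by move/(proportional_scaler u_neq0).
- by move/(proportional_scalel u_neq0).
- by move/(proportional_scalel u_neq0).
Qed.
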